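(* Let $(R,m,K)$ be a complete Noetherian local ring of prime characteristic $p>0$, and let $M$ be an Artinian $R$-module with test modules $\tau_M\subseteq M^\vee$ and $\tau^{fg}_M\subseteq M^\vee$. Then for every ideal $I$ of $R$, $$I^\ast\,\tau_M = I\,\tau_M \qquad\text{and}\qquad I^\ast\,\tau^{fg}_M = I\,\tau^{fg}_M .$$
   Context: Let $(R,m,K)$ be a Noetherian local ring of prime characteristic $p>0$. $R^o$ denotes the complement in $R$ of the union of the minimal primes of $R$. For $e\ge 0$ and $q=p^e$, $R^e$ denotes $R$ viewed as an $R$-bimodule with the usual left structure and with right structure via the iterated Frobenius $r\mapsto r^{q}$; for an $R$-module $M$, $F^e(M):=R^e\otimes_R M$, an $R$-module via the left structure. Tight closure: for a submodule $N\subseteq M$ (no finiteness on $M$ is assumed), $N^{[q]}_M:=\mathrm{Im}(F^e(N)\to F^e(M))$, and $N^\ast_M$ is the set of $u\in M$ for which there is $c\in R^o$ with $c\otimes u\in N^{[q]}_M$ for all $e$ sufficiently large. For an ideal $I$, $I^\ast:=I^\ast_R$. The finitistic tight closure of $0$ in $M$ is $0^{\ast fg}_M:=\bigcup_{M'}0^\ast_{M'}$, the union over all finitely generated submodules $M'\subseteq M$. Test modules: let $E_R(K)$ be the injective hull of $K$ and, for $M$ Artinian, let $M^\vee=\mathrm{Hom}_R(M,E_R(K))$ be the Matlis dual, with evaluation pairing $M^\vee\times M\to E_R(K)$. Define $$\tau_M:=\{n\in M^\vee: n\cdot 0^\ast_M=0\},\qquad \tau^{fg}_M:=\{n\in M^\vee: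 n\cdot 0^{\ast fg}_M=0\},$$ where the product denotes the evaluation pairing. *)

(* Defs.v *)
From HB Require Import structures.
From mathcomp Require Import all_boot all_algebra.
From mathcomp Require Import all_classical.

Set Implicit Arguments.
Unset Strict Implicit.
Unset Printing Implicit Defensive.

Import GRing.Theory.
Local Open Scope classical_set_scope.
Local Open Scope ring_scope.
Local Open Scope quotient_scope.

Section Submodules.
Variables (R : comNzRingType) (V : lmodType R).

Definition sub_mod (N : submodClosed V) : Type := {x : V | x \in N}.

HB.instance Definition _ (N : submodClosed V) := SubChoice.on (sub_mod N).
HB.instance Definition _ (N : submodClosed V) :=
  [SubChoice_isSubLmodule of sub_mod N by <:].

Definition incl (N : submodClosed V) : {linear sub_mod N -> V} :=
  (\val : sub_mod N -> V).

Definition span (A : set V) : {pred V} :=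
  fun x => `[< forall N : submodClosed V, (forall y, A y -> y \in N) -> x \in N >].

Lemma span_submod_closed (A : set V) : submod_closed (span A).
Proof.
split=> [|a x y /asboolP xA /asboolP yA]; apply/asboolP => N AN.
  exact: rpred0.
by apply: rpredD; [apply: rpredZ; exact: xA | exact: yA].
Qed.

HB.instance Definition _ (A : set V) :=
  GRing.isSubmodClosed.Build R V (span A) (span_submod_closed A).

Definition zero_sub : {pred V} := fun x => x == 0.

Lemma zero_sub_closed : submod_closed zero_sub.
Proof.
split=> [|a x y]; rewrite !unfold_in // => /eqP-> /eqP->.
by rewrite scaler0 addr0.
Qed.

HB.instance Definition _ :=
  GRing.isSubmodClosed.Build R V zero_sub zero_sub_closed.

Definition finitely_generated (N : submodClosed V) : Prop :=
  exists s : seq V, N =i span [set` s].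

Definition artinian : Prop :=
  forall N : nat -> submodClosed V,
    (forall n, {subset N n.+1 <= N n}) ->
    exists n0, forall n, (n0 <= n)%N -> N n =i N n0.

Definition smul_span (J : set R) (T : set V) : {pred V} :=
  span [set v | exists a t, [/\ J a, T t & v = a *: t]].

HB.instance Definition _ (J : set R) (T : set V) :=
  GRing.SubmodClosed.on (smul_span J T).

End Submodules.

Section QuotientModule.
Variables (R : comNzRingType) (V : lmodType R) (N : submodClosed V).

(* [submodClosed V] does not inherit from [zmodClosed V], which the library's
   quotient requires. *)
Definition zmod_of_sub : {pred V} := N.

HB.instance Definition _ := GRing.isZmodClosed.Build V zmod_of_sub
  (GRing.submod_closedB (submodClosedP N)).

Definition quot_mod : Type := Quotient.quot zmod_of_sub.

HB.instance Definition _ := GRing.Zmodule.on quot_mod.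
HB.instance Definition _ := EqQuotient.on quot_mod.

Definition quot_proj (x : V) : quot_mod := \pi_quot_mod x.

Lemma quot_projK : cancel (repr : quot_mod -> V) quot_proj.
Proof. exact: reprK. Qed.

Lemma quot_projP (x y : V) : (quot_proj x == quot_proj y) = (x - y \in N).
Proof. exact/esym/(Quotient.idealrBE zmod_of_sub). Qed.

Lemma quot_projD : {morph quot_proj : x y / x + y}.
Proof. by move=> x y; exact: (raddfD (\pi_(Quotient.quot zmod_of_sub))). Qed.

Definition quot_scale (a : R) (x : quot_mod) : quot_mod :=
  quot_proj (a *: repr x).

Lemma quot_scaleE a x : quot_scale a (quot_proj x) = quot_proj (a *: x).
Proof.
apply/eqP; rewrite quot_projP -scalerBr.
have : repr (quot_proj x) - x \in N by rewrite -quot_projP quot_projK.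
exact: rpredZ.
Qed.

Fact quot_scalerA a b x : quot_scale a (quot_scale b x) = quot_scale (a * b) x.
Proof. by rewrite -[x]quot_projK !quot_scaleE scalerA. Qed.

Fact quot_scale1r : left_id 1 quot_scale.
Proof. by move=> x; rewrite -[x]quot_projK quot_scaleE scale1r. Qed.

Fact quot_scalerDr : right_distributive quot_scale +%R.
Proof.
move=> a x y; rewrite -[x]quot_projK -[y]quot_projK -quot_projD !quot_scaleE.
by rewrite scalerDr quot_projD.
Qed.

Fact quot_scalerDl x : {morph quot_scale^~ x : a b / a + b}.
Proof.
by move=> a b; rewrite -[x]quot_projK !quot_scaleE scalerDl quot_projD.
Qed.

HB.instance Definition _ := GRing.Zmodule_isLmodule.Build R quot_mod
  quot_scalerA quot_scale1r quot_scalerDr quot_scalerDl.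

Fact quot_proj_linear : linear quot_proj.
Proof. by move=> a x y; rewrite quot_projD -quot_scaleE. Qed.

HB.instance Definition _ :=
  GRing.isLinear.Build R V quot_mod _ quot_proj quot_proj_linear.

End QuotientModule.

Section FreeModule.
Variables (R : comNzRingType) (X : choiceType).

Definition finsupp : {pred (X -> R^o)} :=
  fun f => `[< finite_set [set x | f x != 0] >].

Lemma finsupp_closed : submod_closed finsupp.
Proof.
split=> [|a f g /asboolP ff /asboolP fg]; apply/asboolP.
  rewrite (_ : [set _ | _] = set0) //.
  by apply/seteqP; split=> x //=; rewrite eqxx.
apply: (@sub_finite_set _ _ ([set x | f x != 0] `|` [set x | g x != 0])).
  move=> x /= afg; case: (eqVneq (f x) 0) => [fx0|]; [right|by left].
  apply: contraNneq afg => gx0; apply/eqP; change (a * f x + g x = 0).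
  by rewrite fx0 gx0 mulr0 addr0.
by rewrite finite_setU.
Qed.

HB.instance Definition _ :=
  GRing.isSubmodClosed.Build R (X -> R^o) finsupp finsupp_closed.

Definition free_mod : Type := sub_mod finsupp.

HB.instance Definition _ := GRing.Lmodule.on free_mod.

Fact free_gen_finsupp (x : X) : (fun y => (y == x)%:R) \in finsupp.
Proof.
apply/asboolP; apply: (sub_finite_set _ (finite_set1 x)) => y /=.
by case: (eqVneq y x) => // _; rewrite mulr0n eqxx.
Qed.

Definition free_gen (x : X) : free_mod :=
  exist (fun f => f \in finsupp) _ (free_gen_finsupp x).

Variables (V : lmodType R) (phi : X -> V).

Definition free_lift (g : free_mod) : V :=
  \sum_(x \in [set: X]) incl finsupp g x *: phi x.

Lemma free_liftE (g : free_mod) (r : seq X) : uniq r ->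
  (forall x, x \notin r -> incl finsupp g x = 0) ->
  free_lift g = \sum_(x <- r) incl finsupp g x *: phi x.
Proof.
move=> ur g0; rewrite /free_lift (fsbigE r) //.
  by apply: eq_bigl => x; exact/mem_set.
by move=> x _ /g0 ->; rewrite scale0r.
Qed.

Fact free_lift_linear : linear free_lift.
Proof.
move=> a g h.
have fin (k : free_mod) : finite_set [set x | incl finsupp k x != 0].
  by case: k => k /= kf; exact/asboolP.
have [sg gE] := (finite_seqP _).1 (fin g).
have [sh hE] := (finite_seqP _).1 (fin h).
set r := undup (sg ++ sh).
have ur : uniq r by rewrite undup_uniq.
have g0 x : x \notin r -> incl finsupp g x = 0.
  rewrite mem_undup mem_cat negb_or => /andP[xg _]; apply/eqP.
  by apply: contraNT xg => gx; change ([set` sg] x); rewrite -gE.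
have h0 x : x \notin r -> incl finsupp h x = 0.
  rewrite mem_undup mem_cat negb_or => /andP[_ xh]; apply/eqP.
  by apply: contraNT xh => hx; change ([set` sh] x); rewrite -hE.
have aghE x :
    incl finsupp (a *: g + h) x = a * incl finsupp g x + incl finsupp h x.
  by rewrite linearP.
rewrite (free_liftE ur g0) (free_liftE ur h0) (free_liftE ur); last first.
  by move=> x xr; rewrite [LHS]aghE g0 // h0 // mulr0 addr0.
rewrite scaler_sumr -big_split /=; apply: eq_bigr => x _.
by rewrite [X in X *: _ = _]aghE scalerDl scalerA.
Qed.

HB.instance Definition _ :=
  GRing.isLinear.Build R free_mod V _ free_lift free_lift_linear.

Lemma free_lift_gen x : free_lift (free_gen x) = phi x.
Proof.
rewrite (@free_liftE _ [:: x]) //.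
  by rewrite big_seq1 /= eqxx scale1r.
by move=> y; rewrite inE => /negPf yx; rewrite /= yx.
Qed.

End FreeModule.

Section Tensor.
Variables (R : comNzRingType) (A : lmodType R) (ract : A -> R -> A).
Variable M : lmodType R.

(* [A] stands for a bimodule: the left structure is that of [lmodType], the right action
   is [ract].  The relation [TensLeft] lets the tensor product be a quotient of
   the free [R]-module, rather than of the free abelian group, on [A * M]. *)
Inductive tensor_rel : set (free_mod R (A * M)%type) :=
| TensAddl a b u : tensor_rel
    (free_gen R (a + b, u) - (free_gen R (a, u) + free_gen R (b, u)))
| TensAddr a u v : tensor_rel
    (free_gen R (a, u + v) - (free_gen R (a, u) + free_gen R (a, v)))
| TensBalanced a r u : tensor_rel
    (free_gen R (ract a r, u) - free_gen R (a, r *: u))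
| TensLeft r a u : tensor_rel
    (free_gen R (r *: a, u) - r *: free_gen R (a, u)).

Definition tensor : Type := quot_mod (span tensor_rel).

HB.instance Definition _ := GRing.Lmodule.on tensor.

Definition tens (a : A) (u : M) : tensor :=
  quot_proj (span tensor_rel) (free_gen R (a, u)).

Fact tensor_rel0 x : tensor_rel x -> quot_proj (span tensor_rel) x = 0.
Proof.
move=> xrel; apply/eqP; rewrite -(linear0 (quot_proj (span tensor_rel))).
by rewrite quot_projP subr0; apply/asboolP => N; apply.
Qed.

Lemma tensDl a b u : tens (a + b) u = tens a u + tens b u.
Proof.
apply/eqP; rewrite -subr_eq0 -!(raddfD, raddfB) /=.
apply/eqP/tensor_rel0; exact: TensAddl.
Qed.

Lemma tensDr a u v : tens a (u + v) = tens a u + tens a v.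
Proof.
apply/eqP; rewrite -subr_eq0 -!(raddfD, raddfB) /=.
apply/eqP/tensor_rel0; exact: TensAddr.
Qed.

Lemma tens_balanced a r u : tens (ract a r) u = tens a (r *: u).
Proof.
apply/eqP; rewrite -subr_eq0 -raddfB /=.
apply/eqP/tensor_rel0; exact: TensBalanced.
Qed.

Lemma tensZl r a u : tens (r *: a) u = r *: tens a u.
Proof.
apply/eqP; rewrite -subr_eq0 -linearZ -raddfB /=.
apply/eqP/tensor_rel0; exact: TensLeft.
Qed.

End Tensor.

Section TensorMap.
Variables (R : comNzRingType) (A : lmodType R) (ract : A -> R -> A).
Variables (M N : lmodType R) (f : {linear M -> N}).

Definition tensor_map (t : tensor ract M) : tensor ract N :=
  free_lift (fun x : A * M => tens ract x.1 (f x.2)) (repr t).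

Let lift := free_lift (fun x : A * M => tens ract x.1 (f x.2)).

Lemma tensor_map_proj g :
  tensor_map (quot_proj (span (@tensor_rel _ _ ract M)) g) = lift g.
Proof.
pose K : {pred free_mod R (A * M)%type} := fun x => lift x == 0.
have Kclosed : submod_closed K.
  split=> [|a x y]; rewrite !unfold_in /K /= /lift; first by rewrite linear0.
  by move=> /eqP x0 /eqP y0; rewrite linearP /= x0 y0 scaler0 addr0.
pose Kmixin := GRing.isSubmodClosed.Build _ _ K Kclosed.
pose KS : submodClosed _ := HB.pack K Kmixin.
apply/eqP; rewrite -subr_eq0 /tensor_map -/lift -raddfB.
set d := _ - _; have : d \in span (@tensor_rel _ _ ract M).
  by rewrite -quot_projP quot_projK.
move=> /asboolP /(_ KS) /=; apply => _ [a b u|a u v|a r u|r a u];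
  apply/eqP; rewrite /lift raddfB ?raddfD ?linearZ /= !free_lift_gen /=.
- by rewrite tensDl -opprD subrr.
- by rewrite raddfD tensDr -opprD subrr.
- by rewrite linearZ tens_balanced subrr.
- by rewrite linearZ /= free_lift_gen tensZl subrr.
Qed.

Lemma tensor_mapE a u : tensor_map (tens ract a u) = tens ract a (f u).
Proof. by rewrite tensor_map_proj /lift free_lift_gen. Qed.

Fact tensor_map_linear : linear tensor_map.
Proof.
move=> a x y; rewrite -[x]quot_projK -[y]quot_projK -linearP.
by rewrite !tensor_map_proj /lift linearP.
Qed.

HB.instance Definition _ := GRing.isLinear.Build R (tensor ract M)
  (tensor ract N) _ tensor_map tensor_map_linear.

End TensorMap.

Section Frobenius.
Variables (p e : nat) (R : comNzRingType).

Definition frob_ract (a : R^o) (r : R) : R^o := a * r ^+ (p ^ e).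

Definition Frob (M : lmodType R) : Type := tensor frob_ract M.

HB.instance Definition _ (M : lmodType R) := GRing.Lmodule.on (Frob M).

Definition Frob_tens (M : lmodType R) (c : R) (u : M) : Frob M :=
  tens frob_ract (c : R^o) u.

Definition Frob_map (M N : lmodType R) (f : {linear M -> N}) : Frob M -> Frob N :=
  tensor_map f.

(* The image of [F^e(N) -> F^e(M)], i.e. the submodule N^[p^e]_M. *)
Definition Frob_power (M : lmodType R) (N : submodClosed M) : set (Frob M) :=
  range (Frob_map (incl N)).

End Frobenius.

Section Rings.
Variable R : comNzRingType.

(* Ideals are the submodules of the regular module; they may be improper,
   unlike those of [ring_quotient]. *)
Local Notation ideal := (submodClosed R^o).

Definition noetherian_ring : Prop := forall I : ideal, finitely_generated I.

Definition maximal_ideal (m : ideal) : Prop :=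
  1 \notin m /\
  forall J : ideal, {subset m <= J} -> 1 \notin J -> {subset J <= m}.

Definition local_ring (m : ideal) : Prop :=
  maximal_ideal m /\ forall m' : ideal, maximal_ideal m' -> m' =i m.

Fixpoint ideal_exp (I : ideal) (n : nat) : {pred R^o} :=
  if n is n'.+1 then smul_span [set x : R | x \in I] [set` ideal_exp I n']
  else predT.

(* The two clauses are the injectivity and the surjectivity of the canonical map
   from [R] to the inverse limit of the [R / m ^ n]. *)
Definition adically_complete (m : ideal) : Prop :=
  (forall x : R, (forall n, x \in ideal_exp m n) -> x = 0) /\
  (forall x : nat -> R, (forall n, x n.+1 - x n \in ideal_exp m n) ->
     exists y : R, forall n, y - x n \in ideal_exp m n).

Definition minimal_prime (P : prime_idealr R) : Prop :=
  forall Q : prime_idealr R, {subset Q <= P} -> Q =i P.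

(* [R^o] in the commutative algebra sense; in MathComp [R^o] is the regular
   module. *)
Definition off_minimal_primes : set R :=
  ~` \bigcup_(P in minimal_prime) [set x : R | x \in P].

End Rings.

Section TightClosure.
Variables (p : nat) (R : comNzRingType).

Definition tight_closure (M : lmodType R) (N : submodClosed M) : set M :=
  [set u | exists2 c, off_minimal_primes c &
    exists e0, forall e, (e0 <= e)%N -> Frob_power N (Frob_tens p e c u)].

Definition zero_tight_closure (M : lmodType R) : set M :=
  tight_closure (@zero_sub R M).

Definition finitistic_zero_tight_closure (M : lmodType R) : set M :=
  \bigcup_(M' in @finitely_generated R M)
    incl M' @` @zero_tight_closure (sub_mod M').

Definition ideal_tight_closure (I : submodClosed R^o) : set R :=
  @tight_closure R^o I.

End TightClosure.

Arguments zero_tight_closure p {R} M.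
Arguments finitistic_zero_tight_closure p {R} M.

Section Hom.
Variables (R : comNzRingType) (M E : lmodType R).

Definition is_linear_map : {pred (M -> E)} := fun f => `[< linear f >].

Lemma is_linear_map_closed : submod_closed is_linear_map.
Proof.
split=> [|a f g /asboolP fl /asboolP gl]; apply/asboolP => b x y.
  by change (0 = b *: 0 + 0 :> E); rewrite scaler0 addr0.
change (a *: f (b *: x + y) + g (b *: x + y)
        = b *: (a *: f x + g x) + (a *: f y + g y)).
rewrite fl gl !scalerDr !scalerA [a * b]mulrC -!addrA; congr (_ + _).
by rewrite addrCA.
Qed.

HB.instance Definition _ := GRing.isSubmodClosed.Build R (M -> E)
  is_linear_map is_linear_map_closed.

Definition Hom : Type := sub_mod is_linear_map.

HB.instance Definition _ := GRing.Lmodule.on Hom.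

Definition ev (n : Hom) (u : M) : E := incl is_linear_map n u.

End Hom.

Section InjectiveHull.
Variables (R : comNzRingType) (E : lmodType R).

Definition injective_module : Prop :=
  forall (A B : lmodType R) (i : {linear A -> B}) (f : {linear A -> E}),
    injective i -> exists g : {linear B -> E}, forall x, g (i x) = f x.

Definition essential_extension (A : lmodType R) (i : {linear A -> E}) : Prop :=
  injective i /\
  forall N : submodClosed E, (exists2 x, x \in N & x <> 0) ->
    exists2 y, i y \in N & i y <> 0.

Definition injective_hull (A : lmodType R) (i : {linear A -> E}) : Prop :=
  injective_module /\ essential_extension i.

End InjectiveHull.

Section TestModules.
Variables (p : nat) (R : comNzRingType) (M E : lmodType R).

Definition test_module : set (Hom M E) :=
  [set n | forall u, zero_tight_closure p M u -> ev n u = 0].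

Definition finitistic_test_module : set (Hom M E) :=
  [set n | forall u, finitistic_zero_tight_closure p M u -> ev n u = 0].

End TestModules.

Arguments test_module p {R} M E.
Arguments finitistic_test_module p {R} M E.

(* Main.v *)
(* Write Z for 0^*_M (or 0^{*fg}_M).  If I u lies in Z then so does I^* u: after
   multiplying by a common element of R^o for the generators of I, the Frobenius
   powers of I kill u.  Since E is a cogenerator, the elements of M killed by
   I tau are exactly the u with I u in Z, so I^* tau vanishes on the annihilator
   of I tau in M.  It remains to see that a submodule N of Hom(M, E) is its own
   double annihilator.  As M is Artinian, finitely many elements of N have the
   same common kernel as N; a map f killing this kernel is, by injectivity of E,
   a combination of them with coefficients in End(E).  Finally End(E) = R: every
   element of E is killed by a power of m, and an endomorphism acts on
   E_n = (0 :_E m^n) as a scalar r_n, with r_{n+1} - r_n in m^n, so that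
   completeness provides a common scalar. *)

From HB Require Import structures.
Require Import Defs.
From mathcomp Require Import all_boot all_algebra.
From mathcomp Require Import all_classical.

Set Implicit Arguments.
Unset Strict Implicit.
Unset Printing Implicit Defensive.

Import GRing.Theory.
Local Open Scope classical_set_scope.
Local Open Scope ring_scope.

(* These names are shadowed by those of vector and functions. *)
Local Notation span := Defs.span.
Local Notation incl := Defs.incl.
Local Notation Hom := Defs.Hom.

(** * Chain conditions, maximal ideals and maps into injective modules *)

Section Generalities.
Variables (R : comNzRingType).

Definition linear_of (A B : lmodType R) (f : A -> B) (fL : linear f) :
    {linear A -> B} :=
  HB.pack f (GRing.isLinear.Build R A B _ f fL).

Section SubmodOf.
Variables (V : lmodType R) (P : set V).
Hypotheses (P0 : P 0) (PL : forall a x y, P x -> P y -> P (a *: x + y)).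

Lemma submod_of_closed : submod_closed (fun x => `[< P x >] : bool).
Proof.
split=> [|a x y /asboolP Px /asboolP Py]; first exact/asboolP.
by apply/asboolP/PL.
Qed.

Definition submod_of : submodClosed V :=
  HB.pack (fun x => `[< P x >])
    (GRing.isSubmodClosed.Build R V _ submod_of_closed).

Lemma submod_ofP x : reflect (P x) (x \in submod_of).
Proof. exact: asboolP. Qed.

End SubmodOf.

Lemma mem_span (V : lmodType R) (A : set V) x : A x -> x \in span A.
Proof. by move=> Ax; apply/asboolP => N; apply. Qed.

Lemma span_min (V : lmodType R) (A : set V) (N : submodClosed V) :
  (forall x, A x -> x \in N) -> {subset span A <= N}.
Proof. by move=> AN x /asboolP; apply. Qed.

Lemma span_ind (V : lmodType R) (A : set V) (P : set V) : P 0 ->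
  (forall a x y, P x -> P y -> P (a *: x + y)) ->
  (forall x, A x -> P x) -> forall x, x \in span A -> P x.
Proof.
move=> P0 PL AP x /(@span_min _ _ (submod_of P0 PL)) xP.
by apply/(submod_ofP P0 PL)/xP => y /AP /(submod_ofP P0 PL).
Qed.

(** Otherwise dependent choice builds a chain in [P] none of whose steps reverses, against
    stationarity. An abstract [le] covers ascending and descending chains alike. *)
Lemma ex_extremal (X : Type) (le : X -> X -> Prop) (P : X -> Prop) x0 :
  (forall F : nat -> X, (forall n, le (F n) (F n.+1)) ->
     exists n, le (F n.+1) (F n)) ->
  P x0 -> exists2 x, P x & forall y, P y -> le x y -> le y x.
Proof.
move=> stat Px0; apply: contrapT => noext.
have next (x : {x | P x}) :
    exists y : {x | P x}, le (sval x) (sval y) /\ ~ le (sval y) (sval x).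
  apply: contrapT => nonext; apply: noext; exists (sval x); first exact: svalP.
  move=> y Py xy; apply: contrapT => yx; apply: nonext.
  by exists (exist _ y Py).
have [step stepP] := choice next.
pose F n := iter n step (exist _ x0 Px0).
have [n] := stat (fun n => sval (F n)) (fun n => (stepP (F n)).1).
exact: (stepP (F n)).2.
Qed.

(** The union of the chain is a submodule, and its finitely many generators already lie in one
    [N n]. *)
Lemma noetherian_stationary (V : lmodType R) :
  (forall N : submodClosed V, finitely_generated N) ->
  forall N : nat -> submodClosed V, (forall n, {subset N n <= N n.+1}) ->
  exists n, {subset N n.+1 <= N n}.
Proof.
move=> fg N Ninc.
have Nle i j : (i <= j)%N -> {subset N i <= N j}.
  move=> /subnKC <-; elim: (j - i)%N => [|k IHk] x xN; first by rewrite addn0.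
  by rewrite addnS; apply/Ninc/IHk.
pose P x := exists n, x \in N n.
have P0 : P 0 by exists 0%N; exact: rpred0.
have PL a x y : P x -> P y -> P (a *: x + y).
  move=> [i xi] [j yj]; exists (maxn i j); apply: rpredD.
    by apply: rpredZ; apply: Nle xi; exact: leq_maxl.
  by apply: Nle yj; exact: leq_maxr.
have [s sE] := fg (submod_of P0 PL).
have sP x : x \in s -> P x.
  by move=> xs; apply/(submod_ofP P0 PL); rewrite sE; exact: mem_span.
have [n nP] : exists n, forall x, x \in s -> x \in N n.
  elim: {sE} s sP => [|x s IHs] sP; first by exists 0%N.
  have [|n nP] := IHs; first by move=> y ys; apply: sP; rewrite inE ys orbT.
  have [k xk] := sP x (mem_head _ _).
  exists (maxn k n) => y; rewrite inE => /predU1P[->|/nP yn].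
    by apply: Nle xk; exact: leq_maxl.
  by apply: Nle yn; exact: leq_maxr.
exists n => x xn; have : x \in submod_of P0 PL.
  by apply/(submod_ofP P0 PL); exists n.+1.
by rewrite sE; apply: span_min.
Qed.

Lemma noetherian_max (V : lmodType R) (P : submodClosed V -> Prop) N0 :
  (forall N : submodClosed V, finitely_generated N) -> P N0 ->
  exists2 N : submodClosed V, P N &
    forall N' : submodClosed V, P N' -> {subset N <= N'} -> {subset N' <= N}.
Proof.
move=> fg; apply: (@ex_extremal _ (fun N N' : submodClosed V => {subset N <= N'})).
exact: noetherian_stationary.
Qed.

Lemma artinian_min (V : lmodType R) (P : submodClosed V -> Prop) N0 :
  artinian V -> P N0 ->
  exists2 N : submodClosed V, P N &
    forall N' : submodClosed V, P N' -> {subset N' <= N} -> {subset N <= N'}.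
Proof.
move=> hV; pose le (N N' : submodClosed V) := {subset N' <= N}.
apply: (@ex_extremal _ le) => N /hV [n nP].
by exists n => x; rewrite (nP n.+1).
Qed.

Lemma proper_sub_max (m J : submodClosed R^o) : noetherian_ring R ->
  local_ring m -> 1 \notin J -> {subset J <= m}.
Proof.
move=> hnoeth [_ mP] J1.
pose P (J' : submodClosed R^o) := {subset J <= J'} /\ 1 \notin J'.
have [|J' [JJ' J'1] J'max] := @noetherian_max _ P J hnoeth; first by split.
move=> x /JJ'; rewrite (mP J') //; split=> // J2 J'J2 J21.
by apply: J'max => //; split=> // y /JJ'/J'J2.
Qed.

Lemma max_ideal_inv (m : submodClosed R^o) (r : R) : maximal_ideal m ->
  (r : R^o) \notin m -> exists s : R, ((1 - s * r : R) : R^o) \in m.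
Proof.
move=> [m1 mmax] rm.
(* [P] describes the ideal [m + R r]; were it proper, maximality would put [r] in [m]. *)
pose P (x : R^o) := exists s : R, ((x - s * r : R) : R^o) \in m.
have P0 : P 0 by exists 0; rewrite mul0r subr0 rpred0.
have PL (a : R) (x y : R^o) : P x -> P y -> P (a *: x + y).
  move=> [s xs] [t yt]; exists (a * s + t).
  have -> : ((a *: x + y - (a * s + t) * r : R) : R^o) =
            a *: ((x - s * r : R) : R^o) + ((y - t * r : R) : R^o).
    change (a * x + y - (a * s + t) * r = a * (x - s * r) + (y - t * r)).
    by rewrite mulrDl mulrBr opprD mulrA addrACA.
  by apply: rpredD => //; exact: rpredZ.
apply: contrapT => P1; case/negP: rm.
have mP : {subset m <= submod_of P0 PL}.
  by move=> x xm; apply/(submod_ofP P0 PL); exists 0; rewrite mul0r subr0.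
apply: (mmax _ mP); first by apply/negP => /(submod_ofP P0 PL).
by apply/(submod_ofP P0 PL); exists 1; rewrite mul1r subrr rpred0.
Qed.

(** Vanishing on the kernel of [n], the map [f] descends to the image of [n]; injectivity extends it
    from there to [B]. *)
Lemma injective_factor (E : lmodType R) : injective_module E ->
  forall (L B : lmodType R) (n : {linear L -> B}) (f : {linear L -> E}),
  (forall x, n x = 0 -> f x = 0) -> exists g : {linear B -> E}, forall x, g (n x) = f x.
Proof.
move=> injE L B n f fn.
pose P y := exists x, n x = y.
have P0 : P 0 by exists 0; exact: linear0.
have PL a x y : P x -> P y -> P (a *: x + y).
  by move=> [x' <-] [y' <-]; exists (a *: x' + y'); rewrite linearP.
have inv (y : sub_mod (submod_of P0 PL)) : exists x, n x = val y.
  exact/(submod_ofP P0 PL)/(valP y).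
have [h hP] := choice inv.
have fE x x' : n x = n x' -> f x = f x'.
  move=> xx'; apply/eqP; rewrite -subr_eq0 -raddfB; apply/eqP/fn.
  by rewrite raddfB /= xx' subrr.
have fhL : linear (fun y => f (h y)).
  by move=> a x y; rewrite -linearP; apply: fE; rewrite hP !linearP !hP.
have [g gP] := injE _ _ (incl (submod_of P0 PL)) (linear_of fhL) val_inj.
exists g => x.
have nx : n x \in submod_of P0 PL by apply/(submod_ofP P0 PL); exists x.
rewrite -[LHS]/(g (incl (submod_of P0 PL) (exist _ (n x) nx))) gP.
by apply: fE; rewrite hP.
Qed.

End Generalities.

(** * Matlis theory of the injective hull of the residue field *)

Section Matlis.
Variables (R : comNzRingType) (m : submodClosed R^o).
Hypotheses (hnoeth : noetherian_ring R) (hloc : local_ring m).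
Variables (E : lmodType R) (iota : {linear quot_mod m -> E}).
Hypothesis hE : injective_hull iota.

Let injE : injective_module E := hE.1.
(** A generator of the copy of the residue field in [E]. *)
Let w : E := iota (quot_proj m (1 : R^o)).

Lemma iota_projE (a : R) : iota (quot_proj m (a : R^o)) = a *: w.
Proof. by rewrite -linearZ -linearZ /= /GRing.scale /= mulr1. Qed.

Lemma hull_gen_eq0 (a : R) : (a *: w == 0) = ((a : R^o) \in m).
Proof.
rewrite -iota_projE -(linear0 iota) (inj_eq hE.2.1).
by rewrite -(linear0 (quot_proj m)) quot_projP subr0.
Qed.

Lemma essential_multiple (x : E) : x != 0 -> exists r : R, exists2 b : R,
  r *: x = b *: w & b *: w != 0.
Proof.
move=> x0; pose P y := exists r : R, r *: x = y.
have P0 : P 0 by exists 0; rewrite scale0r.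
have PL a y z : P y -> P z -> P (a *: y + z).
  by move=> [r <-] [r' <-]; exists (a * r + r'); rewrite scalerDl scalerA.
have [|y] := hE.2.2 (submod_of P0 PL).
  by exists x; [apply/(submod_ofP P0 PL); exists 1; rewrite scale1r|exact/eqP].
rewrite -[y]quot_projK iota_projE => /(submod_ofP P0 PL) [r rx] /eqP b0.
by exists r, (repr y).
Qed.

(** Some [r x] is a nonzero [b w]. Then [r] is outside [m], hence invertible modulo [m], and as [m]
    kills [x] the inverse recovers [x] from [b w]. *)
Lemma socle_gen (x : E) : (forall a : R, (a : R^o) \in m -> a *: x = 0) ->
  exists r : R, x = r *: w.
Proof.
move=> mx; have [->|x0] := eqVneq x 0; first by exists 0; rewrite scale0r.
have [r [b rxE bw0]] := essential_multiple x0.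
have [|s] := @max_ideal_inv _ m r hloc.1.
  by apply: contraNN bw0 => /mx; rewrite rxE => ->.
move=> /mx/eqP; rewrite scalerBl scale1r subr_eq0 => /eqP ->.
by exists (s * b); rewrite -!scalerA rxE.
Qed.

(** The annihilator of the class of [u] in [M / Z] is proper, so it lies in [m], which kills [w].
    Thus [r u |-> r w] is well defined and extends to [M / Z]. *)
Lemma cogenerator (M : lmodType R) (Z : submodClosed M) (u : M) : u \notin Z ->
  exists2 f : {linear M -> E}, (forall z, z \in Z -> f z = 0) & f u <> 0.
Proof.
move=> uZ.
have scaleL : linear (fun r : R^o => (r : R) *: quot_proj Z u).
  by move=> a x y; rewrite scalerDl scalerA.
have [|g gP] := injective_factor injE (n := linear_of scaleL)
    (f := iota \o quot_proj m).
  move=> r /= ru; apply/eqP; rewrite iota_projE hull_gen_eq0.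
  pose P (a : R^o) := (a : R) *: quot_proj Z u = 0.
  have P0 : P 0 by rewrite /P scale0r.
  have PL (a : R) (y z : R^o) : P y -> P z -> P (a *: y + z).
    by move=> yu zu; rewrite /P scalerDl zu addr0 -scalerA yu scaler0.
  apply: (@proper_sub_max _ m (submod_of P0 PL)) => //; last first.
    exact/(submod_ofP P0 PL).
  apply/negP => /(submod_ofP P0 PL); rewrite /P scale1r => /eqP.
  by rewrite -(linear0 (quot_proj Z)) quot_projP subr0 (negPf uZ).
exists (g \o quot_proj Z) => [z zZ|] /=.
  have -> : quot_proj Z z = 0.
    by apply/eqP; rewrite -(linear0 (quot_proj Z)) quot_projP subr0.
  exact: linear0.
have := gP (1 : R^o); rewrite /= scale1r => ->; apply/eqP.
by rewrite iota_projE hull_gen_eq0 hloc.1.1.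
Qed.

(* Induction on [k], restricting [f] to the kernel of the last [n i]. *)
Lemma scalar_combination (S : set E) :
  (forall g : {linear E -> E}, exists r : R, forall x, S x -> g x = r *: x) ->
  forall k (L : lmodType R) (f : {linear L -> E}) (n : nat -> {linear L -> E}),
  (forall i x, (i < k)%N -> S (n i x)) ->
  (forall x, (forall i, (i < k)%N -> n i x = 0) -> f x = 0) ->
  exists r : nat -> R, forall x, f x = \sum_(i < k) r i *: n i x.
Proof.
move=> hS; elim=> [|k IHk] L f n nS fn.
  by exists (fun=> 0) => x; rewrite big_ord0 fn.
pose P x := n k x = 0.
have P0 : P 0 by exact: linear0.
have PL a x y : P x -> P y -> P (a *: x + y).
  by rewrite /P linearP => -> ->; rewrite scaler0 addr0.
pose ker := incl (submod_of P0 PL).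
have [||r rP] := IHk _ (f \o ker) (fun i => n i \o ker).
- by move=> i x ik; apply: nS; exact: ltnW.
- move=> x xk; apply: fn => i; rewrite ltnS leq_eqVlt => /predU1P[->|/xk//].
  exact/(submod_ofP P0 PL)/(valP x).
have gL : linear (fun x => f x - \sum_(i < k) r i *: n i x).
  move=> a x y; rewrite linearP scalerBr scaler_sumr addrACA -opprD.
  rewrite -big_split /=; congr (_ - _); apply: eq_bigr => i _.
  by rewrite linearP scalerDr !scalerA mulrC.
(* The difference vanishes on the kernel of [n k], so it is [g] after [n k] for an endomorphism [g]
   of [E]. *)
have [|g gP] := injective_factor injE (n := n k) (f := linear_of gL).
  move=> x nx; have xk : x \in submod_of P0 PL by exact/(submod_ofP P0 PL).
  have /= := rP (exist _ x xk); rewrite /ker /= => ->.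
  by rewrite subrr.
have [c cP] := hS g.
exists (fun i => if (i < k)%N then r i else c) => x.
rewrite big_ord_recr /= ltnn -cP; last exact: nS.
rewrite gP /= (eq_bigr (fun i : 'I_k => r i *: n i x)); first by rewrite subrKC.
by move=> i _; rewrite ltn_ord.
Qed.

Lemma ideal_exp_closed n : submod_closed (ideal_exp m n).
Proof. by case: n => [|n] //=; exact: span_submod_closed. Qed.

Definition ideal_exp_sub n : submodClosed R^o :=
  HB.pack (ideal_exp m n)
    (GRing.isSubmodClosed.Build R R^o _ (ideal_exp_closed n)).

Lemma mem_ideal_expS n (a b : R) : (a : R^o) \in m ->
  (b : R^o) \in ideal_exp m n -> ((a * b : R) : R^o) \in ideal_exp m n.+1.
Proof. by move=> am bm; apply: mem_span; exists a, b. Qed.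

Definition tors n : set E :=
  fun x => forall a : R, (a : R^o) \in ideal_exp m n -> a *: x = 0.

Lemma tors0 n : tors n 0.
Proof. by move=> a _; rewrite scaler0. Qed.

Lemma torsL n (a : R) x y : tors n x -> tors n y -> tors n (a *: x + y).
Proof.
move=> xn yn b bn; rewrite scalerDr yn // addr0 scalerA mulrC -scalerA.
by rewrite xn // scaler0.
Qed.

Definition tors_sub n := submod_of (@tors0 n) (@torsL n).

(** [m^(n+1)] is spanned by products of an element of [m] and one of [m^n], so torsion can be tested
    one factor at a time. *)
Lemma torsSP n x :
  tors n.+1 x <-> forall a : R, (a : R^o) \in m -> tors n (a *: x).
Proof.
split=> [xn a am b bn|xn].
  by rewrite scalerA mulrC; apply: xn; exact: mem_ideal_expS.
apply: (@span_ind _ R^o _ (fun c => (c : R) *: x = 0)).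
- exact: scale0r.
- move=> a y z yx zx.
  by rewrite scalerDl zx addr0 -scalerA yx scaler0.
- by move=> _ [a [b [am bn ->]]]; rewrite -[a *: b]/(a * b) mulrC -scalerA xn.
Qed.

Lemma torsS n x : tors n x -> tors n.+1 x.
Proof.
move=> xn; apply/torsSP => a _.
by rewrite -[_ *: _]addr0; exact: torsL (@tors0 _).
Qed.

Lemma tors_le i j x : (i <= j)%N -> tors i x -> tors j x.
Proof.
move=> /subnKC <- xi; elim: (j - i)%N => [|k IHk]; first by rewrite addn0.
by rewrite addnS; exact: torsS.
Qed.

Lemma ann0 (V : lmodType R) (x : V) : (0 : R) *: x = 0.
Proof. exact: scale0r. Qed.

Lemma annL (V : lmodType R) (x : V) (a b c : R) :
  b *: x = 0 -> c *: x = 0 -> (a * b + c) *: x = 0.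
Proof. by move=> bx cx; rewrite scalerDl cx addr0 -scalerA bx scaler0. Qed.

Definition ann (V : lmodType R) (x : V) : submodClosed R^o :=
  @submod_of R R^o (fun a : R => a *: x = 0) (ann0 x) (@annL V x).

Lemma annP (V : lmodType R) (x : V) (a : R) :
  reflect (a *: x = 0) ((a : R^o) \in ann x).
Proof. exact: (submod_ofP (V := R^o)). Qed.

(* Take a counterexample [x] with maximal annihilator.  Some generator [a] of [m]
   keeps [a x] a counterexample, so [ann (a x) = ann x]; but a nonzero multiple
   of [x] in the socle is killed by [a]. *)
Lemma hull_tors x : exists n, tors n x.
Proof.
apply: contrapT => xbad.
pose bad x := ~ exists n, tors n x.
have [_ [y [ybad ->]] ymax] := @noetherian_max _ _
  (fun J => exists y, bad y /\ J = ann y) (ann x) hnoeth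
  (ex_intro _ x (conj xbad erefl)).
have [s sE] := hnoeth m.
have sm a : a \in s -> a \in m by move=> sa; rewrite sE; exact: mem_span.
have [[a as_ aybad]|good] := pselect (exists2 a : R, a \in s & bad (a *: y)).
  have anny (b : R) : b *: (a *: y) = 0 -> b *: y = 0.
    move=> /annP bay; apply/annP; move: bay.
    apply: ymax; first by exists (a *: y).
    move=> c /annP cy; apply/annP.
    by rewrite scalerA mulrC -scalerA cy scaler0.
  have y0 : y != 0.
    by apply/eqP => y0; apply: ybad; exists 0%N; rewrite y0; exact: tors0.
  have [r [b ryE]] := essential_multiple y0.
  rewrite -ryE anny ?eqxx // scalerA mulrC -scalerA ryE scalerA mulrC -scalerA.
  by have /sm := as_; rewrite -hull_gen_eq0 => /eqP ->; rewrite scaler0.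
(* Now each [a y] is torsion; a common exponent [n] for the finitely many generators puts [y] in
   [tors n.+1]. *)
apply: ybad.
have [n nP] : exists n, forall a : R, a \in s -> tors n (a *: y).
  have {good} : forall a : R, a \in s -> exists n, tors n (a *: y).
    by move=> a as_; apply: contrapT => abad; apply: good; exists a.
  elim: {sE sm} s => [|a s IHs] sy; first by exists 0%N.
  have [|n nP] := IHs; first by move=> b bs; apply: sy; rewrite inE bs orbT.
  have [k ka] := sy a (mem_head _ _).
  exists (maxn k n) => b; rewrite inE => /predU1P[->|/nP yn].
    by apply: tors_le ka; exact: leq_maxl.
  by apply: tors_le yn; exact: leq_maxr.
exists n.+1; apply/torsSP => a; rewrite sE.
apply: (@span_ind _ R^o _ (fun c => tors n ((c : R) *: y))) => //.
  by rewrite scale0r; exact: tors0.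
by move=> b c d cy dy; rewrite scalerDl -scalerA; exact: torsL.
Qed.

(** [g w] is again killed by [m], hence a multiple [c w], and [w] generates the whole socle. *)
Lemma end_socle (g : {linear E -> E}) : exists r : R,
  forall x, tors 1 x -> g x = r *: x.
Proof.
have tors1 x : tors 1 x -> forall a : R, (a : R^o) \in m -> a *: x = 0.
  (* [ideal_exp m 1] is spanned by products [a * b] with [b] arbitrary, hence the factor 1. *)
  move=> x1 a am; rewrite -[a]mulr1.
  by apply: x1; exact: (@mem_ideal_expS 0).
have w1 (a : R) : (a : R^o) \in m -> a *: w = 0.
  by rewrite -hull_gen_eq0 => /eqP.
have [|c cP] := @socle_gen (g w).
  by move=> a am; rewrite -linearZ /= w1 // linear0.
exists c => x /tors1/socle_gen [r ->].
by rewrite linearZ /= cP !scalerA mulrC.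
Qed.

(* Generators [s_i] of [m^n] map [E_{n+1}] to the socle and their common kernel is
   [E_n], where [g - r] vanishes; hence [g - r] is a combination of them. *)
Lemma end_tors_lift (g : {linear E -> E}) n (r : R) :
  (forall x, tors n x -> g x = r *: x) ->
  exists r' : R, ((r' - r : R) : R^o) \in ideal_exp m n /\
    forall x, tors n.+1 x -> g x = r' *: x.
Proof.
move=> gr.
have [s sE] := hnoeth (ideal_exp_sub n).
have sm i : ((s`_i : R) : R^o) \in ideal_exp_sub n.
  (* Beyond the size of [s] the default value is 0, which lies in the ideal. *)
  have [|si] := ltnP i (size s); last by rewrite nth_default ?rpred0.
  by move=> /(mem_nth 0) si; rewrite sE; exact: mem_span.
pose T := incl (tors_sub n.+1).
have TP (x : sub_mod (tors_sub n.+1)) : tors n.+1 (T x).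
  exact/(submod_ofP (@tors0 _) (@torsL _))/(valP x).
have scaleL (c : R) : linear (fun x : E => c *: x).
  by move=> a x y; rewrite scalerDr !scalerA mulrC.
have gL : linear (fun x => g x - r *: x).
  move=> a x y; rewrite linearP scalerBr scalerDr opprD addrACA.
  by rewrite !scalerA mulrC.
have [||c cP] := @scalar_combination (tors 1) end_socle (size s) _
    (linear_of gL \o T) (fun i => linear_of (scaleL s`_i) \o T).
- move=> i x _; apply/torsSP => a am b _ /=.
  rewrite [_ *: (s`_i *: _)]scalerA TP ?scaler0 //.
  by apply: mem_ideal_expS => //; exact: sm.
- move=> x /= sx; rewrite gr ?subrr // => a.
  rewrite -[a \in _]/(a \in ideal_exp_sub n) sE.
  apply: (@span_ind _ R^o _ (fun c => (c : R) *: T x = 0)) => //.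
  + exact: scale0r.
  + by move=> b c d cx dx; exact: annL.
  + by move=> b /(nthP 0) [i si <-]; exact: sx.
exists (r + \sum_(i < size s) c i * s`_i); split.
  rewrite addrAC subrr add0r.
  apply: (@rpred_sum _ (ideal_exp_sub n)) => i _.
  exact: (@rpredZ _ _ (ideal_exp_sub n)).
move=> x xn; have xT : x \in tors_sub n.+1.
  exact/(submod_ofP (@tors0 _) (@torsL _)).
have /= := cP (exist _ x xT); rewrite /T /= => /eqP; rewrite subr_eq => /eqP ->.
rewrite scalerDl scaler_suml addrC; congr (_ + _).
by apply: eq_bigr => i _; rewrite scalerA.
Qed.

Hypothesis hcompl : adically_complete m.

Lemma hull_end (g : {linear E -> E}) : exists r : R, forall x, g x = r *: x.
Proof.
pose ok n r := forall x, tors n x -> g x = r *: x.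
have next (nr : {nr : nat * R | ok nr.1 nr.2}) : exists r' : R,
    (((r' - (sval nr).2 : R) : R^o) \in ideal_exp m (sval nr).1 /\
    ok (sval nr).1.+1 r').
  by case: nr => -[n r] /= /end_tors_lift.
have [f fP] := choice next.
(* [m^0] is the whole ring, so [E_0] is zero and the scalar 0 can start the recursion. *)
have ok0 : ok 0%N 0.
  by move=> x x0; rewrite -[x]scale1r x0 ?linear0 ?scaler0.
pose F n := iter n (fun nr => exist (fun nr => ok nr.1 nr.2)
  ((sval nr).1.+1, f nr) (fP nr).2) (exist _ (0%N, 0) ok0).
have F1 n : (sval (F n)).1 = n by elim: n => //= n ->.
have [|y yP] := hcompl.2 (fun n => (sval (F n)).2).
  by move=> n; have := (fP (F n)).1; rewrite F1.
(* [y - r_n] lies in [m^n], hence kills [E_n], and every [x] lies in some [E_n]. *)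
exists y => x; have [n xn] := hull_tors x.
have := svalP (F n); rewrite F1 => -> //; apply/esym/eqP.
by rewrite -subr_eq0 -scalerBl; apply/eqP/xn/yP.
Qed.

End Matlis.

(** * Double annihilators in the Matlis dual *)

Section DoubleAnnihilator.
Variables (R : comNzRingType) (m : submodClosed R^o).
Hypotheses (hnoeth : noetherian_ring R) (hloc : local_ring m).
Hypothesis hcompl : adically_complete m.
Variables (E : lmodType R) (iota : {linear quot_mod m -> E}).
Hypothesis hE : injective_hull iota.
Variable M : lmodType R.
Hypothesis hM : artinian M.

Lemma ev_linear (n : Hom M E) : linear (ev n).
Proof. exact/asboolP/(valP n). Qed.

Lemma ev_at_linear (u : M) : linear (fun n : Hom M E => ev n u).
Proof. by []. Qed.

Lemma evZ (a : R) (n : Hom M E) (u : M) : ev (a *: n) u = ev n (a *: u).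
Proof. by rewrite -[RHS]/(linear_of (ev_linear n) _) linearZ. Qed.

Lemma double_annihilator (N : submodClosed (Hom M E)) (f : Hom M E) :
  (forall u, (forall n, n \in N -> ev n u = 0) -> ev f u = 0) -> f \in N.
Proof.
move=> fN.
(* [P] singles out the common kernels of finite lists in [N]; the empty list gives [M]. *)
pose P (K : submodClosed M) := exists2 s : seq (Hom M E), {subset s <= N} &
  forall u, u \in K <-> forall n, n \in s -> ev n u = 0.
have PT : P (submod_of (P := setT) I (fun _ _ _ _ _ => I)).
  by exists [::] => // u; split=> // _; exact/asboolP.
have [K [s sN sK] Kmin] := artinian_min hM PT.
have KN u : u \in K -> forall n, n \in N -> ev n u = 0.
  move=> uK n nN.
  (* Adding [n] to the list cuts [K] down to [Q], so minimality forces [n] to vanish on [K]. *)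
  pose Q v := v \in K /\ ev n v = 0.
  have Q0 : Q 0.
    by split; [exact: rpred0|exact: (linear0 (linear_of (ev_linear n)))].
  have QL a x y : Q x -> Q y -> Q (a *: x + y).
    move=> [xK nx] [yK ny]; split; first by rewrite rpredD ?rpredZ.
    by rewrite ev_linear nx ny scaler0 addr0.
  suff : u \in submod_of Q0 QL by move=> /(submod_ofP Q0 QL) [].
  apply: Kmin uK; last by move=> v /(submod_ofP Q0 QL) [].
  exists (n :: s).
    by move=> n'; rewrite inE => /predU1P[->|/sN].
  move=> v; split=> [/(submod_ofP Q0 QL) [/sK vs vn] n'|vs].
    by rewrite inE => /predU1P[->|/vs].
  apply/(submod_ofP Q0 QL); split; last by apply: vs; rewrite mem_head.
  by apply/sK => n' n's; apply: vs; rewrite inE n's orbT.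
have endT (g : {linear E -> E}) : exists r : R, forall x, setT x -> g x = r *: x.
  by have [r rP] := hull_end hnoeth hloc hE hcompl g; exists r.
have [//||r rP] := scalar_combination hE endT (k := size s)
    (f := linear_of (ev_linear f)) (n := fun i => linear_of (ev_linear s`_i)).
  move=> u su; apply: fN; apply: KN; apply/sK => n /(nthP 0) [i si <-].
  exact: su.
have -> : f = \sum_(i < size s) r i *: s`_i.
  apply/val_inj/funext => u; rewrite -[LHS]/(ev f u) [LHS]rP.
  rewrite -[RHS]/(linear_of (ev_at_linear u) _) raddf_sum.
  exact: eq_bigr.
by apply: rpred_sum => i _; apply/rpredZ/sN/mem_nth.
Qed.

(** Common core of both equalities, with [T] the annihilator of [Z]. By double annihilation, [a n]
    lies in [I T] once it vanishes at every [u] killed by [I T]. *)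
Lemma smul_span_ann (Z : submodClosed M) (I J : set R) (T : set (Hom M E)) :
  I `<=` J ->
  (forall u, (forall i, I i -> i *: u \in Z) -> forall a, J a -> a *: u \in Z) ->
  (forall n, T n <-> forall u, u \in Z -> ev n u = 0) ->
  smul_span J T =i smul_span I T.
Proof.
move=> IJ IZ TZ f; apply/idP/idP; last first.
  apply: span_min => _ [a [n [aI nT ->]]]; apply: mem_span.
  by exists a, n; split=> //; exact: IJ.
apply: span_min => _ [a [n [aJ nT ->]]]; apply: double_annihilator => u uN.
rewrite evZ; apply: (TZ n).1 => //; apply: IZ aJ => i iI.
(* If [i u] were outside [Z], some [g] in [T] would not vanish at [i u], although [i g] kills
   [u]. *)
apply: contrapT => /negP /(cogenerator hnoeth hloc hE) [g gZ]; apply.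
have gH : (g : M -> E) \in @is_linear_map R M E.
  by apply/asboolP; exact: linearP.
pose g' : Hom M E := exist _ (g : M -> E) gH.
rewrite -[LHS]/(ev g' (i *: u)) -evZ; apply: uN; apply: mem_span.
by exists i, g'; split=> //; apply/TZ.
Qed.

End DoubleAnnihilator.

(** * Frobenius powers and the tight closure of zero *)

Section TightClosureFacts.
Variables (p : nat) (R : comNzRingType).

Lemma off_minimal_primes1 : off_minimal_primes (1 : R).
Proof. by move=> [P _ /=]; rewrite idealr1. Qed.

Lemma off_minimal_primesM (c d : R) : off_minimal_primes c ->
  off_minimal_primes d -> off_minimal_primes (c * d).
Proof.
move=> cP dP [P Pmin]; rewrite /= prime_idealrM => /orP[cin|din].
  by apply: cP; exists P.
by apply: dP; exists P.
Qed.

Lemma Frob_tensD e (M : lmodType R) (c : R) (u v : M) :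
  Frob_tens p e c (u + v) = Frob_tens p e c u + Frob_tens p e c v.
Proof. exact: tensDr. Qed.

Lemma Frob_tens0 e (M : lmodType R) (c : R) : Frob_tens p e c (0 : M) = 0.
Proof.
apply: (addrI (Frob_tens p e c (0 : M))).
by rewrite -Frob_tensD !addr0.
Qed.

Lemma Frob_tensM e (M : lmodType R) (a c : R) (u : M) :
  Frob_tens p e (a * c) u = a *: Frob_tens p e c u.
Proof. exact: tensZl. Qed.

Lemma Frob_tensZ e (M : lmodType R) (a c : R) (u : M) :
  Frob_tens p e c (a *: u) = a ^+ (p ^ e) *: Frob_tens p e c u.
Proof.
rewrite -Frob_tensM [in RHS]mulrC; exact/esym/tens_balanced.
Qed.

Lemma Frob_map_tens e (M N : lmodType R) (f : {linear M -> N}) (c : R) (u : M) :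
  Frob_map f (Frob_tens p e c u) = Frob_tens p e c (f u).
Proof. exact: tensor_mapE. Qed.

Lemma Frob_map_linear e (M N : lmodType R) (f : {linear M -> N}) :
  linear (@Frob_map p e R M N f).
Proof. exact: tensor_map_linear. Qed.

Lemma Frob_map0 e (M N : lmodType R) (f : {linear M -> N}) :
  @Frob_map p e R M N f 0 = 0.
Proof. exact: (linear0 (linear_of (Frob_map_linear f))). Qed.

(** A representative of [t] in the free module writes [Frob_map f t] as a finite combination of
    elementary tensors. *)
Lemma Frob_map_mem e (M N : lmodType R) (f : {linear M -> N})
    (P : submodClosed (Frob p e N)) :
  (forall c u, Frob_tens p e c (f u) \in P) -> forall t, Frob_map f t \in P.
Proof.
move=> fP t; apply: rpred_sum => -[c u] _; apply: rpredZ; exact: fP.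
Qed.

(** The image of [F^e(0)] is generated by the tensors of 0, so tight closure of zero becomes a
    vanishing condition. *)
Lemma Frob_power0 e (M : lmodType R) (t : Frob p e M) :
  Frob_power (@zero_sub R M) t <-> t = 0.
Proof.
split=> [[x _ <-]|->].
  suff : Frob_map (incl (@zero_sub R M)) x \in @zero_sub R (Frob p e M).
    by move=> /eqP.
  apply: Frob_map_mem => c [u u0] /=.
  by move: (u0) => /eqP ->; apply/eqP; exact: Frob_tens0.
by exists 0 => //; exact: Frob_map0.
Qed.

Lemma zero_tight_closureP (M : lmodType R) (u : M) :
  zero_tight_closure p M u <-> exists2 c : R, off_minimal_primes c &
    exists e0, forall e, (e0 <= e)%N -> Frob_tens p e c u = 0.
Proof.
by split=> -[c cP [e0 e0P]]; exists c => //; exists e0 => e /e0P /Frob_power0.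
Qed.

Lemma zero_tight_closure0 (M : lmodType R) : zero_tight_closure p M 0.
Proof.
apply/zero_tight_closureP; exists 1; first exact: off_minimal_primes1.
by exists 0%N => e _; exact: Frob_tens0.
Qed.

Lemma zero_tight_closureL (M : lmodType R) (a : R) (x y : M) :
  zero_tight_closure p M x -> zero_tight_closure p M y ->
  zero_tight_closure p M (a *: x + y).
Proof.
move=> /zero_tight_closureP [c cP [e0 cx]] /zero_tight_closureP [d dP [e1 dy]].
apply/zero_tight_closureP; exists (c * d); first exact: off_minimal_primesM.
exists (maxn e0 e1) => e; rewrite geq_max => /andP[/cx cxe /dy dye].
rewrite Frob_tensD Frob_tensZ [Frob_tens p e _ y]Frob_tensM dye.
rewrite mulrC Frob_tensM cxe.
by rewrite !scaler0 addr0.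
Qed.

Definition zero_tight_closure_sub (M : lmodType R) :=
  submod_of (@zero_tight_closure0 M) (@zero_tight_closureL M).

Lemma zero_tight_closure_subP (M : lmodType R) (u : M) :
  reflect (zero_tight_closure p M u) (u \in zero_tight_closure_sub M).
Proof. exact: submod_ofP. Qed.

Lemma zero_tight_closure_map (M N : lmodType R) (f : {linear M -> N}) (u : M) :
  zero_tight_closure p M u -> zero_tight_closure p N (f u).
Proof.
move=> /zero_tight_closureP [c cP [e0 cu]].
apply/zero_tight_closureP; exists c => //; exists e0 => e /cu cue.
by rewrite -Frob_map_tens cue; exact: Frob_map0.
Qed.

Lemma sub_ideal_tight_closure (I : submodClosed R^o) :
  [set x : R | x \in I] `<=` ideal_tight_closure p I.
Proof.
move=> a aI; exists 1; first exact: off_minimal_primes1.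
exists 0%N => e _; exists (Frob_tens p e 1 (exist _ a aI : sub_mod I)) => //.
exact: (Frob_map_tens e (incl I)).
Qed.

(** The list being finite, the multipliers can be multiplied together and the largest exponent bound
    taken. *)
Lemma zero_tight_closure_uniform (M : lmodType R) (s : seq M) :
  (forall x, x \in s -> zero_tight_closure p M x) ->
  exists2 d : R, off_minimal_primes d & exists e0, forall e, (e0 <= e)%N ->
    forall x, x \in s -> Frob_tens p e d x = 0.
Proof.
elim: s => [|x s IHs] sP.
  by exists 1; [exact: off_minimal_primes1|exists 0%N].
have [|d dP [e0 ds]] := IHs; first by move=> y ys; apply: sP; rewrite inE ys orbT.
have /zero_tight_closureP [c cP [e1 cx]] := sP x (mem_head _ _).
exists (c * d); first exact: off_minimal_primesM.
exists (maxn e0 e1) => e; rewrite geq_max => /andP[/ds dse /cx cxe] y.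
rewrite inE => /predU1P[->|/dse dy].
  by rewrite mulrC Frob_tensM cxe scaler0.
by rewrite Frob_tensM dy scaler0.
Qed.

(* If [c (x) a] is in [I^[q]] and [d (x) x u = 0] for generators [x] of [I],
   then the map [R -> M, r |-> r u] sends [c (x) a] to an element killed by [d]. *)
Lemma ideal_tight_closure_scale (I : submodClosed R^o) (M : lmodType R) (u : M) :
  finitely_generated I ->
  (forall i : R, (i : R^o) \in I -> zero_tight_closure p M (i *: u)) ->
  forall a : R, ideal_tight_closure p I a -> zero_tight_closure p M (a *: u).
Proof.
move=> [s sE] Iu a [c cP [e0 ca]].
have [|d dP [e1 du]] := @zero_tight_closure_uniform M [seq (i : R) *: u | i <- s].
  by move=> _ /mapP [i si ->]; apply: Iu; rewrite sE; exact: mem_span.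
apply/zero_tight_closureP; exists (d * c); first exact: off_minimal_primesM.
exists (maxn e0 e1) => e; rewrite geq_max => /andP[/ca [t _ tE] /du due].
have scaleL : linear (fun r : R^o => (r : R) *: u).
  by move=> b x y; rewrite scalerDl scalerA.
rewrite Frob_tensM -[a *: u]/(linear_of scaleL (a : R^o)) -Frob_map_tens -tE.
pose P (z : Frob p e M) := d *: z = 0.
have P0 : P 0 by exact: scaler0.
have PL (b : R) x y : P x -> P y -> P (b *: x + y).
  by rewrite /P scalerDr => xd ->; rewrite addr0 scalerA mulrC -scalerA xd scaler0.
(* [Q] is the preimage in [F^e(R)] of the elements killed by [d]; being a submodule, it need only be
   tested on tensors of elements of [I]. *)
pose Q (z : Frob p e R^o) := P (Frob_map (linear_of scaleL) z).
have Q0 : Q 0.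
  by rewrite /Q Frob_map0.
have QL (b : R) x y : Q x -> Q y -> Q (b *: x + y).
  by rewrite /Q Frob_map_linear; exact: PL.
apply/(submod_ofP Q0 QL)/Frob_map_mem => b [x xI].
apply/(submod_ofP Q0 QL); rewrite /Q Frob_map_tens /P /= -Frob_tensM.
rewrite mulrC Frob_tensM; move: xI; rewrite sE => xI.
suff -> : Frob_tens p e d ((x : R) *: u) = 0 by rewrite scaler0.
(* The map [y |-> d (x) y u] is additive and Frobenius semilinear, so its vanishing spreads from the
   generators to [I]. *)
move: x xI; apply: (@span_ind _ R^o _ (fun y => Frob_tens p e d ((y : R) *: u) = 0)).
- by rewrite scale0r; exact: Frob_tens0.
- move=> r y z yu zu.
  by rewrite scalerDl -scalerA Frob_tensD zu Frob_tensZ yu scaler0 addr0.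
- by move=> y ys; apply: due; apply/mapP; exists y.
Qed.

End TightClosureFacts.

(** * The finitistic tight closure as a directed union *)

Section Finitistic.
Variables (p : nat) (R : comNzRingType) (M : lmodType R).

Definition sub_incl (N N' : submodClosed M) (NN' : {subset N <= N'})
    (x : sub_mod N) : sub_mod N' :=
  exist _ (val x) (NN' _ (valP x)).

Lemma sub_incl_linear (N N' : submodClosed M) (NN' : {subset N <= N'}) :
  linear (sub_incl NN').
Proof. by move=> a x y; exact: val_inj. Qed.

(** Stated inside [M], so that closures in different submodules become comparable. *)
Definition zero_closure_in (N : submodClosed M) (u : M) : Prop :=
  exists2 v : sub_mod N, zero_tight_closure p (sub_mod N) v & val v = u.

Lemma zero_closure_in_mono (N N' : submodClosed M) u :
  {subset N <= N'} -> zero_closure_in N u -> zero_closure_in N' u.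
Proof.
move=> NN' [v v0 <-]; exists (sub_incl NN' v) => //.
exact: (zero_tight_closure_map (linear_of (sub_incl_linear NN'))).
Qed.

Lemma zero_closure_in0 N : zero_closure_in N 0.
Proof. by exists 0 => //; exact: zero_tight_closure0. Qed.

Lemma zero_closure_inL N (a : R) x y :
  zero_closure_in N x -> zero_closure_in N y -> zero_closure_in N (a *: x + y).
Proof.
move=> [x' x0 <-] [y' y0 <-]; exists (a *: x' + y');
  first exact: zero_tight_closureL.
by rewrite linearP.
Qed.

Lemma span_mono (s t : seq M) :
  {subset s <= t} -> {subset span [set` s] <= span [set` t]}.
Proof. by move=> st; apply: span_min => x /st xt; exact: mem_span. Qed.

(** Indexing by lists of generators makes the union visibly directed: lists concatenate, and the
    closure grows with the submodule. *)
Lemma finitistic_zero_tight_closureP u :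
  finitistic_zero_tight_closure p M u <->
  exists s : seq M, zero_closure_in (span [set` s]) u.
Proof.
split=> [[N [s sE] [v v0 <-]]|[s [v v0 <-]]].
  exists s; have Ns : {subset N <= span [set` s]} by move=> x; rewrite sE.
  by apply: zero_closure_in_mono Ns _; exists v.
by exists (span [set` s] : submodClosed M); [exists s|exists v].
Qed.

Lemma finitistic_zero_tight_closure0 : finitistic_zero_tight_closure p M 0.
Proof.
by apply/finitistic_zero_tight_closureP; exists [::]; exact: zero_closure_in0.
Qed.

Lemma finitistic_zero_tight_closureL (a : R) x y :
  finitistic_zero_tight_closure p M x -> finitistic_zero_tight_closure p M y ->
  finitistic_zero_tight_closure p M (a *: x + y).
Proof.
move=> /finitistic_zero_tight_closureP [s xs].
move=> /finitistic_zero_tight_closureP [t yt].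
apply/finitistic_zero_tight_closureP; exists (s ++ t); apply: zero_closure_inL.
  by apply: zero_closure_in_mono xs; apply: span_mono => z zs; rewrite mem_cat zs.
by apply: zero_closure_in_mono yt; apply: span_mono => z zt; rewrite mem_cat zt orbT.
Qed.

(** One finitely generated submodule can contain [u] and witness [i u] for every generator [i] of
    [I]; [ideal_tight_closure_scale] then applies inside it. *)
Lemma ideal_tight_closure_scale_fg (I : submodClosed R^o) (u : M) :
  finitely_generated I ->
  (forall i : R, (i : R^o) \in I -> finitistic_zero_tight_closure p M (i *: u)) ->
  forall a : R, ideal_tight_closure p I a ->
    finitistic_zero_tight_closure p M (a *: u).
Proof.
move=> Ifg Iu a aI; have [t tE] := Ifg.
have [s us su] : exists2 s : seq M, u \in span [set` s] &
    forall i : R, i \in t -> zero_closure_in (span [set` s]) (i *: u).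
  have {Iu} : forall i : R, i \in t -> finitistic_zero_tight_closure p M (i *: u).
    by move=> i it; apply: Iu; rewrite tE; exact: mem_span.
  elim: {tE} t => [|i t IHt] tu.
    by exists [:: u] => //; apply: mem_span; exact: mem_head.
  have [|s us su] := IHt; first by move=> j jt; apply: tu; rewrite inE jt orbT.
  have /finitistic_zero_tight_closureP [s' is'] := tu i (mem_head _ _).
  have ss' : {subset span [set` s] <= span [set` s ++ s']}.
    by apply: span_mono => z zs; rewrite mem_cat zs.
  exists (s ++ s'); first exact: ss'.
  move=> j; rewrite inE => /predU1P[->|/su ju]; last exact: zero_closure_in_mono ju.
  by apply: zero_closure_in_mono is'; apply: span_mono => z zs; rewrite mem_cat zs orbT.
apply/finitistic_zero_tight_closureP; exists s.
pose u' : sub_mod (span [set` s]) := exist _ u us.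
exists (a *: u') => //; apply: ideal_tight_closure_scale Ifg _ _ aI => i.
(* Witnesses are known for generators only; the closure being a submodule, they extend to all of
   [I]. *)
rewrite tE.
apply: (@span_ind _ R^o _ (fun y => zero_tight_closure p _ ((y : R) *: u'))).
- by rewrite scale0r; exact: zero_tight_closure0.
- by move=> r y z yu zu; rewrite scalerDl -scalerA; exact: zero_tight_closureL.
- by move=> y /su [v v0 vE]; rewrite (_ : _ *: u' = v) //; exact: val_inj.
Qed.

End Finitistic.

Theorem theorem2p3 (R : comNzRingType) (m : submodClosed R^o) (p : nat)
    (hnoeth : noetherian_ring R) (hloc : local_ring m)
    (hchar : p \in [pchar R]) (hcompl : adically_complete m)
    (E : lmodType R) (iota : {linear quot_mod m -> E})
    (hE : injective_hull iota)
    (M : lmodType R) (hM : artinian M) (I : submodClosed R^o) :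
  smul_span (ideal_tight_closure p I) (test_module p M E)
    =i smul_span [set x : R | x \in I] (test_module p M E) /\
  smul_span (ideal_tight_closure p I) (finitistic_test_module p M E)
    =i smul_span [set x : R | x \in I] (finitistic_test_module p M E).
Proof.
split.
  apply: (smul_span_ann hnoeth hloc hcompl hE hM (Z := zero_tight_closure_sub p M)).
  - exact: sub_ideal_tight_closure.
  - move=> u Iu a aI; apply/zero_tight_closure_subP.
    apply: ideal_tight_closure_scale (hnoeth I) _ _ aI => i iI.
    exact/zero_tight_closure_subP/Iu.
  - by move=> n; split=> nZ u /zero_tight_closure_subP; exact: nZ.
(* The directed union is a submodule, so it can take the place of [0^*_M]. *)
pose Z := submod_of (@finitistic_zero_tight_closure0 p R M)
  (@finitistic_zero_tight_closureL p R M).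
have ZP u : reflect (finitistic_zero_tight_closure p M u) (u \in Z).
  exact: submod_ofP.
apply: (smul_span_ann hnoeth hloc hcompl hE hM (Z := Z)).
- exact: sub_ideal_tight_closure.
- move=> u Iu a aI; apply/ZP.
  apply: ideal_tight_closure_scale_fg (hnoeth I) _ _ aI => i iI.
  exact/ZP/Iu.
- by move=> n; split=> nZ u /ZP; exact: nZ.
Qed.
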